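(* Let $n\ge1$ and let $F$ be a facet of ${\cal H}(B(n))$. Then there exist a strict linear order $L$ on $\{1,\dots,n\}$ and a spanning tree $T$ of $K_n$ such that $F=\Phi(L,T,\mathcal O)$, where $\mathcal O$ is the orientation of $T$ opposite to $L$.
   Context: For $n\ge1$, $B(n)$ denotes the aperiodic Brandt semigroup: the set $(\{1,\dots,n\}\times\{1,\dots,n\})\cup\{0\}$, where $0$ is a zero element and $(i,j)(k,l)=(i,l)$ if $j=k$ and $(i,j)(k,l)=0$ otherwise. Its set of idempotents is $E(B(n))=\{0\}\cup\{(i,i)\mid1\le i\le n\}$. For $Y\subseteq B(n)$, $Y^+$ denotes the subsemigroup generated by $Y$ ($\emptyset^+=\emptyset$). The subsemigroup complex ${\cal H}(B(n))$ has vertex set $B(n)$, and a subset $X$ is a face iff it admits an enumeration $x_1,\dots,x_k$ with $\emptyset\subset\{x_1\}^+\subset\cdots\subset\{x_1,\dots,x_k\}^+$ (all inclusions strict); a facet is a maximal face. $K_n$ is the complete undirected graph on $\{1,\dots,n\}$. Given a strict linear order $<_L$ on $\{1,\dots,n\}$ and a spanning tree $T$ of $K_n$, the orientation $\mathcal O$ of $T$ opposite to $L$ is $\mathcal O=\{(p,q)\mid \{p,q\}\in T,\ q<_L p\}$, and $$\Phi(L,T,\mathcal O)=\{0\}\cup\{(i,j)\mid i<_L j\}\cup E(B(n))\cup\mathcal O.$$ *)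

(* Defs.v *)
From HB Require Import structures.
From mathcomp Require Import all_boot.

Set Implicit Arguments.
Unset Strict Implicit.
Unset Printing Implicit Defensive.

#[short(type="finSemigroupType")]
HB.structure Definition FinSemigroup := {G of Semigroup G & Finite G}.

Section SubsemigroupComplex.

Variable S : finSemigroupType.
Implicit Types (A X Y F : {set S}) (s : seq S).

(* The empty set counts as a subsemigroup. *)
Definition subsemigroup A :=
  [forall x in A, forall y in A, (x * y)%g \in A].

Lemma subsemigroupP A : reflect (mulg_closed A) (subsemigroup A).
Proof.
apply: (iffP forall_inP) => [clA x y Ax Ay | clA x Ax].
  exact: (forall_inP (clA x Ax)).
by apply/forall_inP => y; apply: clA.
Qed.

(* Y^+ *)
Definition subsemigroup_gen Y := \bigcap_(A : {set S} | (Y \subset A) && subsemigroup A) A.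

Lemma subsemigroup_gen0 : subsemigroup_gen set0 = set0.
Proof.
apply/eqP; rewrite -subset0; apply: bigcap_inf; rewrite subxx /=.
by apply/forall_inP => x; rewrite inE.
Qed.

Definition idempotents : {set S} := [set x | (x * x)%g == x].

(* The step i = 0 reads set0 \proper {x_1}^+ (see subsemigroup_gen0); strictness
   makes the entries of s pairwise distinct. *)
Definition strict_chain s := forall i, i < size s ->
  subsemigroup_gen [set x in take i s] \proper
  subsemigroup_gen [set x in take i.+1 s].

Definition face X := exists2 s, X = [set x in s] & strict_chain s.

Definition facet F := face F /\ forall X, face X -> F \subset X -> X = F.

End SubsemigroupComplex.

(* None is the zero element. *)
Definition brandt (n : nat) := option ('I_n * 'I_n).

HB.instance Definition _ n := Finite.on (brandt n).

Section Brandt.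

Variable n : nat.

Definition brandt_mul (x y : brandt n) : brandt n :=
  match x, y with
  | Some (i, j), Some (k, l) => if j == k then Some (i, l) else None
  | _, _ => None
  end.

Lemma brandt_mulA : associative brandt_mul.
Proof.
move=> [[i j]|] [[k l]|] [[p q]|] //=; last by case: ifP.
by case: (boolP (l == p)); case: (boolP (j == k)) => //= Hjk Hlp;
  rewrite ?Hjk ?Hlp ?(negPf Hjk) ?(negPf Hlp).
Qed.

End Brandt.

HB.instance Definition _ n := isSemigroup.Build (brandt n) (@brandt_mulA n).

Lemma idempotents_brandt n :
  idempotents (brandt n) = None |: [set Some (i, i) | i : 'I_n].
Proof.
apply/setP => -[[i j]|]; rewrite !inE //= /mul /=.
apply/eqP/imsetP => [|[k _ [-> ->]]]; last by rewrite eqxx.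
by case: eqP => // -> _; exists i.
Qed.

Section Graphs.

Variable V : finType.
Implicit Type T : {set {set V}}.

Definition complete_graph : {set {set V}} := [set e : {set V} | #|e| == 2].

Definition adj T : rel V := [rel p q | [set p; q] \in T].

Definition connected_graph T := forall p q, connect (adj T) p q.

(* A walk back and forth along an edge is a ucycle of size 2. *)
Definition acyclic_graph T := forall c, ucycle (adj T) c -> size c <= 2.

Definition spanning_tree T :=
  [/\ T \subset complete_graph, connected_graph T & acyclic_graph T].

Definition strict_linear_order (L : rel V) :=
  [/\ irreflexive L, transitive L & forall p q, p != q -> L p q || L q p].

Definition opposite_orientation (L : rel V) T : {set V * V} :=
  [set e | ([set e.1; e.2] \in T) && L e.2 e.1].

End Graphs.

(* The spanning tree matters only through its orientation O. *)
Definition Phi n (L : rel 'I_n) (O : {set 'I_n * 'I_n}) : {set brandt n} :=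
  [set None] :|: [set Some e | e in [set e : 'I_n * 'I_n | L e.1 e.2]]
  :|: idempotents (brandt n) :|: [set Some e | e in O].

(* Main.v *)
Require Import Defs.
From mathcomp Require Import all_boot.

(* Apart from 0 and the idempotents, which may always be put first, a face is a
   sequence of arcs (p, q) none of which lies in the reachability preorder of
   the earlier ones. Order the points so that the classes of all these preorders
   are intervals. The back arcs, taken in their original order after all the
   ascending pairs, are still independent, so a facet consists of all the
   ascending pairs and a maximal independent sequence of back arcs. By maximality
   each back arc merges exactly two intervals of mutually reachable points, and
   in the end a single interval is left: the back arcs form a spanning tree. *)

(** * Independent sequences of arcs and rankings of the points *)

Section IndependentArcs.

Set Implicit Arguments.
Unset Strict Implicit.

Variable V : finType.
Implicit Types (s m l : seq (V * V)) (a : V * V) (x y z : V) (f g h : V -> nat).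

Definition arc_rel s : rel V := [rel x y | (x, y) \in s].

Definition reach s : rel V := connect (arc_rel s).

(* The newest arc comes first. *)
Fixpoint indep s :=
  if s is a :: s' then ~~ reach s' a.1 a.2 && indep s' else true.

Lemma connect_min (e W : rel V) :
  reflexive W -> transitive W -> subrel e W -> subrel (connect e) W.
Proof.
move=> W0 Wt eW x y /connectP[p]; elim: p x => [|z p IHp] x /= => [_ -> //|].
by case/andP=> /eW xz pz yE; apply: Wt xz _; apply: IHp.
Qed.

Lemma reach_arc s a : a \in s -> reach s a.1 a.2.
Proof. by case: a => x y xy; apply: connect1. Qed.

Lemma reach_sub s1 s2 : (forall a, a \in s1 -> reach s2 a.1 a.2) ->
  subrel (reach s1) (reach s2).
Proof. by move=> s12; apply: connect_sub => x y; apply: (s12 (x, y)). Qed.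

Lemma reach_subset s1 s2 : {subset s1 <= s2} -> subrel (reach s1) (reach s2).
Proof. by move=> s12; apply: reach_sub => a /s12; apply: reach_arc. Qed.

Lemma reach_trans s : transitive (reach s).
Proof. exact: connect_trans. Qed.

Lemma reach_nil x y : reach [::] x y = (x == y).
Proof.
apply/idP/eqP => [|-> //]; last exact: connect0.
by case/connectP => -[|z p] //=.
Qed.

(** Of a path using [a], keep only what precedes the first use and what follows the last. Formally,
    the right-hand side is a preorder containing all the arcs. *)
Lemma reach_cons a s x y : reach (a :: s) x y ->
  reach s x y || reach s x a.1 && reach s a.2 y.
Proof.
pose W := [rel x y | reach s x y || reach s x a.1 && reach s a.2 y].
apply: (@connect_min _ W) => {x y} [x|y x z|x y]; rewrite /W /=.
- by rewrite /reach connect0.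
- case/orP=> [xy|/andP[xa ay]] /orP[yz|/andP[ya az]].
  + by rewrite (reach_trans xy yz).
  + by rewrite (reach_trans xy ya) az orbT.
  + by rewrite xa (reach_trans ay yz) orbT.
  + by rewrite xa az orbT.
- rewrite /arc_rel /= inE; case/predU1P=> [<-|/reach_arc -> //].
  by rewrite /reach !connect0 orbT.
Qed.

Lemma reach_le s f : (forall a, a \in s -> f a.1 <= f a.2) ->
  forall x y, reach s x y -> f x <= f y.
Proof.
move=> sf; apply: (@connect_min _ [rel x y | f x <= f y]) => [x|y x z|x y] /=.
- by [].
- exact: leq_trans.
- exact: (sf (x, y)).
Qed.

Lemma indep_cat s1 s2 : indep (s1 ++ s2) -> indep s2.
Proof. by elim: s1 => //= a s1 IH /andP[_]. Qed.

Lemma indep_uniq s : indep s -> uniq s.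
Proof.
elim: s => //= a s IHs /andP[nr /IHs ->]; rewrite andbT.
by apply: contra nr; apply: reach_arc.
Qed.

Lemma indep_neq s a : indep s -> a \in s -> a.1 != a.2.
Proof.
elim: s => //= b s IHs /andP[nr /IHs IH]; rewrite inE.
case/predU1P=> [->|//]; apply: contra nr => /eqP->; exact: connect0.
Qed.

(* A preorder is determined by its down-sets, so any numbering of the sets that
   is monotone in the cardinal linearises the quotient partial order. *)
Lemma linear_extension s : {f : V -> nat |
  (forall x y, reach s x y -> f x <= f y) &
  (forall x y, f x = f y -> reach s x y)}.
Proof.
pose D x := [set z | reach s z x].
pose N := #|{: {set V}}|.
have ltN (A : {set V}) : enum_rank A < N by apply: ltn_ord.
exists (fun x => #|D x| * N + enum_rank (D x)) => x y.
- move=> xy; have sD : D x \subset D y.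
    by apply/subsetP=> z; rewrite !inE => /reach_trans; apply.
  have [->//|nD] := eqVneq (D x) (D y).
  have lt : #|D x| < #|D y| by apply: proper_card; rewrite properEneq nD.
  apply: leq_trans (leq_addr _ _).
  apply: leq_trans (_ : #|D x|.+1 * N <= _); last by rewrite leq_mul2r lt orbT.
  by rewrite mulSn addnC leq_add2r ltnW.
- move=> E; have/(congr1 (modn^~ N)) := E.
  rewrite !modnMDl !modn_small // => /ord_inj/enum_rank_inj/setP/(_ x).
  by rewrite !inE /reach connect0 => <-.
Qed.

(* [g] ranks the classes of the preorder of [s]; refining it by the preorders
   of the shorter and shorter tails of [s] keeps every class an interval of the
   resulting order [h]. *)
Lemma interval_ranking s g : indep s ->
  (forall x y, reach s x y -> g x <= g y) ->
  (forall x y, g x = g y -> reach s x y) ->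
  exists h, [/\ injective h, forall x y, h x <= h y -> g x <= g y
    & forall l, indep l -> (forall a, a \in l -> h a.1 <= h a.2) ->
      indep ([seq a <- s | h a.2 < h a.1] ++ l)].
Proof.
elim: s g => [|a s IHs] g /=.
  move=> _ gle geq; exists g; split=> // x y /geq.
  by rewrite reach_nil => /eqP.
case/andP=> nra inds gle geq.
have [k kle keq] := linear_extension s.
pose N := (\max_x k x).+1.
have kN x : k x < N by rewrite ltnS leq_bigmax.
pose g' x := g x * N + k x.
have sS : subrel (reach s) (reach (a :: s)).
  by apply: reach_subset => b; rewrite inE orbC => ->.
have gg' x y : g' x <= g' y -> g x <= g y.
  move/(leq_div2r N); rewrite /g' !divnMDl // !divn_small //.
  by rewrite !addn0.
have g'le x y : reach s x y -> g' x <= g' y.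
  by move=> xy; rewrite leq_add ?kle // leq_mul2r gle ?orbT // sS.
have g'eq x y : g' x = g' y -> reach s x y.
  move/(congr1 (modn^~ N)); rewrite !modnMDl !modn_small //; exact: keq.
have [h [hinj hle hind]] := IHs g' inds g'le g'eq.
exists h; split=> // [x y /hle/gg' //|l indl lle].
case: ifP => [lta|_]; last exact: hind.
(* Neither the kept arcs of [s] nor those of [l] decrease [g'], so [ra] gives [g' a.1 <= g' a.2]. As
   [a] descends for [h], the two values agree, and [s] alone already leads from [a.1] to [a.2]. *)
rewrite /= hind // andbT; apply: contra nra => ra; apply: g'eq; apply/eqP.
rewrite eqn_leq (hle a.2) ?(ltnW lta) // andbT.
move: ra; apply: reach_le => b; rewrite mem_cat mem_filter.
by case/orP=> [/andP[_ /reach_arc/g'le]|/lle/hle].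
Qed.

Lemma indep_ranking s : indep s ->
  exists2 h, injective h &
    forall l, indep l -> (forall a, a \in l -> h a.1 <= h a.2) ->
      indep ([seq a <- s | h a.2 < h a.1] ++ l).
Proof.
move=> inds; have [g gle geq] := linear_extension s.
by have [h [? _ ?]] := interval_ranking inds gle geq; exists h.
Qed.

(* Arcs are added by decreasing length, so that a new arc is shorter than
   every arc already there. *)
Lemma indep_ascending h : injective h ->
  {l | indep l & forall a, (a \in l) = (h a.1 < h a.2)}.
Proof.
move=> hinj; pose d a := h a.2 - h a.1.
pose l := sort (relpre d leq) (enum [pred a | h a.1 < h a.2]).
have lE a : (a \in l) = (h a.1 < h a.2) by rewrite mem_sort mem_enum.
exists l => //; have := sort_sorted (fun a b => leq_total (d a) (d b))
  (enum [pred a | h a.1 < h a.2]); rewrite -/l.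
have: uniq l by rewrite sort_uniq enum_uniq.
have: all [pred a | h a.1 < h a.2] l by apply/allP=> a; rewrite lE.
elim: l {lE} => //= -[x y] l IHl /andP[/= xy hl] /andP[nl ul] pl.
(* The first arc [(x, z)] of a path from [x] to [y] is at least as long as [(x, y)], so
   [h y <= h z]. The rest ascends, hence [z = y], and [(x, y)] would occur twice. *)
rewrite IHl ?(path_sorted pl) // andbT; apply/negP=> /connectP[p].
case: p => [|z p] /= => [_ E|/andP[xz zp] E]; first by rewrite E ltnn in xy.
have zy : h z <= h y.
  apply: (@reach_le l) => [a /(allP hl)/ltnW//|].
  by apply/connectP; exists p.
have ltr: transitive (relpre d leq) by move=> ? ? ?; apply: leq_trans.
have := allP (order_path_min ltr pl) _ xz; rewrite /= /d /=.
have lxz := allP hl _ xz; rewrite /= in lxz.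
rewrite leq_sub2rE ?(ltnW lxz) // => yz.
have zE : z = y by apply: hinj; apply/eqP; rewrite eqn_leq zy.
by rewrite -zE (xz : (x, z) \in l) in nl.
Qed.

(** * Maximal independent sequences and the tree of their back arcs *)

Definition max_indep s :=
  indep s /\ forall s', indep s' -> {subset s <= s'} -> {subset s' <= s}.

Lemma max_indep_size s s' : max_indep s -> indep s' -> {subset s <= s'} ->
  size s' <= size s.
Proof.
by move=> [_ smax] inds' ss'; rewrite uniq_leq_size ?indep_uniq //; apply: smax.
Qed.

(** An unreachable pair could be adjoined as one more arc. *)
Lemma max_indep_total s x y : max_indep s -> reach s x y.
Proof.
move=> smax; apply: contraT => nxy.
have := @max_indep_size s ((x, y) :: s) smax; rewrite /= nxy ltnn.
by apply; [case: smax | move=> a; rewrite inE orbC => ->].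
Qed.

Definition edge_set s : {set {set V}} := [set [set a.1; a.2] | a in s].

Lemma adj_sym (T : {set {set V}}) : symmetric (adj T).
Proof. by move=> x y; rewrite /adj /= setUC. Qed.

Lemma edge_set_cons a s :
  edge_set (a :: s) = [set a.1; a.2] |: edge_set s.
Proof.
apply/setP=> e; rewrite !inE; apply/imsetP/orP => [[b]|].
  rewrite inE; case/predU1P=> [-> ->|bs ->]; first by left.
  by right; apply/imsetP; exists b.
case=> [/eqP->|/imsetP[b bs ->]]; first by exists a; rewrite ?mem_head.
by exists b; rewrite // inE bs orbT.
Qed.

(** A cycle of length at least 3 must use the new edge. Rotated to start there, it leaves a path in
    [T] joining the ends of that edge. *)
Lemma acyclic_add_edge (T : {set {set V}}) p q :
  acyclic_graph T -> ~~ connect (adj T) p q ->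
  acyclic_graph ([set p; q] |: T).
Proof.
move=> acT npq c /andP[cyc uc]; rewrite leqNgt; apply/negP=> c3.
have [cT|] := boolP (cycle (adj T) c).
  by have := acT c; rewrite /ucycle /ucycleb cT uc leqNgt c3 => /(_ isT).
move=> ncT; have: ~~ all (fun x => adj T x (next c x)) c.
  by apply: contra ncT => /allP; apply: cycle_from_next.
case/allPn=> x xc nx.
have := next_cycle cyc xc; rewrite {1}/adj /= !inE.
rewrite [_ \in T](negPf nx) orbF => /eqP xE.
have [i c' cE] := rot_to xc.
move: nx xE; rewrite -(next_rot i uc); move: cyc uc c3.
rewrite -(rot_cycle i) -(rot_uniq i) -(size_rot i) cE.
case: c' {cE} => [|y [|z c']] //=.
rewrite eqxx => /and3P[_ yz zp] /and4P[xn yn zn uc] _ nxy xE.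
have yx: y != x by apply: contra xn => /eqP<-; rewrite mem_head.
have zx: z != x by apply: contra xn => /eqP<-; rewrite !inE eqxx orbT.
have zy: z != y by apply: contra yn => /eqP<-; rewrite mem_head.
move: npq yz zp; rewrite -xE => npq yz zp.
(* After [z] the cycle avoids [y], and [z] differs from [x] and [y], so the remaining edges are all
   old. *)
have in_T u v : u != y -> v != y -> adj ([set x; y] |: T) u v -> adj T u v.
  move=> uy vy; rewrite /adj /= in_setU1 => /orP[/eqP/setP/(_ y)|//].
  by rewrite !inE eqxx orbT !(eq_sym y) (negPf uy) (negPf vy).
have {}yz: adj T y z.
  move: yz; rewrite /adj /= in_setU1 => /orP[/eqP/setP/(_ z)|//].
  by rewrite !inE eqxx orbT (negPf zx) (negPf zy).
have {}zp: path (adj T) z (rcons c' x).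
  apply: (@sub_in_path _ [pred v | v != y]) zp => [u v|]; first exact: in_T.
  rewrite /= zy all_rcons /= eq_sym yx; apply/allP=> v vc /=.
  by apply: contra yn => /eqP <-; rewrite inE vc orbT.
case/negP: npq.
have yTx : connect (adj T) y x.
  apply: connect_trans (connect1 yz) _.
  by apply/connectP; exists (rcons c' x); rewrite ?last_rcons.
have xTy : connect (adj T) x y by rewrite (sym_connect_sym (adj_sym T)).
have: q \in [set x; y] by rewrite xE set22.
have: p \in [set x; y] by rewrite xE set21.
rewrite !inE => /orP[]/eqP-> /orP[]/eqP-> //; exact: connect0.
Qed.

Section BackArcs.

Variables (h : V -> nat) (m l : seq (V * V)).
Hypotheses (hinj : injective h) (lE : forall a, (a \in l) = (h a.1 < h a.2)).
Hypothesis mback : forall a, a \in m -> h a.2 < h a.1.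
Hypothesis smax : max_indep (m ++ l).

Let T m' := edge_set m'.

Let reach_up m' x y : h x <= h y -> reach (m' ++ l) x y.
Proof.
rewrite leq_eqVlt => /predU1P[/hinj->|xy]; first exact: connect0.
by apply: (@reach_arc _ (x, y)); rewrite mem_cat lE xy orbT.
Qed.

(** A back arc leads one way along its edge, the ascending pair in [l] the other way. *)
Let adj_reach m' x y : {subset m' <= m} -> adj (T m') x y -> reach (m' ++ l) x y.
Proof.
move=> sm /imsetP[a am E].
have : x \in [set a.1; a.2] by rewrite -E set21.
have : y \in [set a.1; a.2] by rewrite -E set22.
have ra : reach (m' ++ l) a.1 a.2 by apply: reach_arc; rewrite mem_cat am.
have ra' : reach (m' ++ l) a.2 a.1 by apply: reach_up; rewrite ltnW ?mback ?sm.
by rewrite !inE => /orP[]/eqP-> /orP[]/eqP-> //; exact: connect0.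
Qed.

(** Were the ends of a back arc already connected by earlier back edges, [adj_reach] would
    contradict its independence. *)
Lemma back_edges_acyclic : acyclic_graph (edge_set m).
Proof.
have [inds _] := smax.
suff: forall m', {subset m' <= m} -> indep (m' ++ l) -> acyclic_graph (T m').
  exact.
elim=> [_ _ c /andP[cyc _]|a m' IH sm /= /andP[nra indm']].
  case: c cyc => [|x [|y c]] //= /andP[].
  by case/imsetP.
have sm' : {subset m' <= m} by move=> b bm; rewrite sm // inE bm orbT.
rewrite /T edge_set_cons; apply: acyclic_add_edge; first exact: IH.
apply: contra nra; apply: connect_sub => x y; exact: adj_reach.
Qed.

(* Otherwise adding the arc [(r, a.2)] just before [a] would give a larger
   independent sequence. *)
Let between m1 a m2 r : m = m1 ++ a :: m2 -> h a.2 < h r < h a.1 ->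
  reach (m2 ++ l) r a.2 || reach (m2 ++ l) a.1 r.
Proof.
move=> mE /andP[pr rq]; apply: contraT; rewrite negb_or => /andP[nrp nqr].
have [inds _] := smax.
set t := m2 ++ l in nrp nqr *; have sE : m ++ l = m1 ++ a :: t.
  by rewrite mE -catA.
have /= /andP[nqp indt] : indep (a :: t) by apply: (@indep_cat m1); rewrite -sE.
(* Once [a] is present, [(r, a.2)] adds nothing: [r] ascends to [a.1] and then follows [a]. So the
   arcs of [m1] stay independent. *)
have at_sub : subrel (reach (a :: (r, a.2) :: t)) (reach (a :: t)).
  apply: reach_sub => b; rewrite !inE => /or3P[/eqP->|/eqP->|bt] /=.
  - by apply: reach_arc; rewrite mem_head.
  - apply: (@reach_trans _ a.1); first exact: (@reach_up (a :: m2) _ _ (ltnW rq)).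
    by apply: reach_arc; rewrite mem_head.
  - by apply: reach_arc; rewrite inE bt orbT.
have ind2 : indep (a :: (r, a.2) :: t).
  rewrite /= nrp indt !andbT; apply/negP=> /reach_cons /=.
  by rewrite (negPf nqp) (negPf nqr).
have ind3 m3 : indep (m3 ++ a :: t) -> indep (m3 ++ a :: (r, a.2) :: t).
  elim: m3 => // b m3 IH /= /andP[nrb /IH ->]; rewrite andbT.
  apply: contra nrb; apply: reach_sub => c; rewrite mem_cat => /orP[cm|ct].
    by apply: reach_arc; rewrite mem_cat cm.
  apply: (@reach_subset (a :: t)) => [d dt|]; first by rewrite mem_cat dt orbT.
  by apply: at_sub; apply: reach_arc.
have := @max_indep_size _ (m1 ++ a :: (r, a.2) :: t) smax.
rewrite sE !size_cat /= !addnS ltnn; apply.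
  by apply: ind3; rewrite -sE.
move=> b; rewrite !mem_cat !inE.
by case/or3P=> ->; rewrite ?orbT.
Qed.

(** Induction on the tails [m2] of [m]: points mutually reachable through [m2 ++ l] are connected by
    the edges of [m2]. For [m] itself, all points are mutually reachable by maximality. *)
Lemma back_edges_connected : connected_graph (edge_set m).
Proof.
suff: forall m1 m2, m = m1 ++ m2 -> forall x y, reach (m2 ++ l) x y ->
    reach (m2 ++ l) y x -> connect (adj (T m2)) x y.
  by move=> con x y; apply: (con [::]) => //; apply: max_indep_total.
move=> m1 m2; elim: m2 m1 => [|a m2 IH] m1 mE.
  have lle x y : reach l x y -> h x <= h y.
    by apply: reach_le => a; rewrite lE; apply: ltnW.
  move=> x y /lle xy /lle yx.
  have -> : x = y by apply: hinj; apply/eqP; rewrite eqn_leq xy.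
  exact: connect0.
have {}IH := IH (rcons m1 a); rewrite cat_rcons in IH.
have {}IH := IH mE.
pose R := reach (m2 ++ l).
have Tsub : subrel (connect (adj (T m2))) (connect (adj (T (a :: m2)))).
  apply: connect_sub => x y xy; apply: connect1.
  by move: xy; rewrite /T edge_set_cons /adj /= in_setU1 => ->; rewrite orbT.
have Tsym : symmetric (connect (adj (T (a :: m2)))).
  exact/sym_connect_sym/adj_sym.
have am : a \in m by rewrite mE mem_cat mem_head orbT.
have pq := mback am.
suff main x y : h x < h y -> reach (a :: m2 ++ l) y x ->
    connect (adj (T (a :: m2))) x y.
  move=> x y xy yx; case: (ltngtP (h x) (h y)) => [hxy|hyx|/hinj->].
  - exact: main.
  - by rewrite Tsym; apply: main.
  - exact: connect0.
move=> hxy /reach_cons; have xy := reach_up m2 (ltnW hxy).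
case/orP=> [yx|/andP[yq px]]; first by apply: Tsub; apply: IH.
have [yx|nyx] := boolP (R y x); first by apply: Tsub; apply: IH.
(* Here [y] reaches [x] only through [a], so [x] is not above [a.1]; strictly between [a.2] and
   [a.1], [between] applies. Dually for [y]. Thus [a] joins the class of [x] to that of [y]. *)
have xp : R x a.2.
  have [|hpx] := leqP (h x) (h a.2); first exact: reach_up.
  have [hqx|hxq] := leqP (h a.1) (h x).
    by case/negP: nyx; apply: reach_trans yq _; apply: reach_up.
  have /orP[//|qx] := between mE (introT andP (conj hpx hxq)).
  by case/negP: nyx; apply: reach_trans yq _.
have qy : R a.1 y.
  have [|hyq] := leqP (h a.1) (h y); first exact: reach_up.
  have [hyp|hpy] := leqP (h y) (h a.2).
    by case/negP: nyx; apply: (@reach_trans _ a.2) => //; apply: reach_up.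
  have /orP[yp|//] := between mE (introT andP (conj hpy hyq)).
  by case/negP: nyx; apply: (@reach_trans _ a.2).
apply: connect_trans (Tsub _ _ (IH _ _ xp px)) _.
apply: connect_trans (connect1 _) (Tsub _ _ (IH _ _ qy yq)).
by rewrite /T edge_set_cons /adj /= setUC setU11.
Qed.

Lemma back_edges_spanning_tree : spanning_tree (edge_set m).
Proof.
split; [|exact: back_edges_connected|exact: back_edges_acyclic].
apply/subsetP=> e /imsetP[a am ->]; rewrite inE cards2.
by case: (eqVneq a.1 a.2) (mback am) => // ->; rewrite ltnn.
Qed.

(** An edge determines its back arc, since only one of its orientations descends. *)
Lemma mem_back_edges x y :
  ((x, y) \in m) = ([set x; y] \in edge_set m) && (h y < h x).
Proof.
apply/idP/andP=> [xym|[/imsetP[a am E] yx]].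
  by split; [apply/imsetP; exists (x, y) | exact: (mback xym)].
have : x \in [set a.1; a.2] by rewrite -E set21.
have : y \in [set a.1; a.2] by rewrite -E set22.
case: a am (mback am) yx {E} => p q /= am qp yx; rewrite !inE.
case/orP=> /eqP yE /orP[]/eqP xE; move: yx; subst; rewrite ?ltnn //.
by rewrite ltnNge ltnW.
Qed.

End BackArcs.

Theorem max_indep_tree s : max_indep s ->
  exists (L : rel V) (E : {set {set V}}),
    [/\ strict_linear_order L, spanning_tree E
      & forall a, (a \in s) = L a.1 a.2 || (a \in opposite_orientation L E)].
Proof.
move=> [inds smax]; have [h hinj hind] := indep_ranking inds.
have [l indl lE] := indep_ascending hinj.
pose m := [seq a <- s | h a.2 < h a.1].
have mback a : a \in m -> h a.2 < h a.1 by rewrite mem_filter => /andP[].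
have indml : indep (m ++ l) by apply: hind => // a; rewrite lE; apply: ltnW.
(* An arc of [s] outside [m] is no loop, so it ascends and lies in [l]. Maximality of [s] then makes
   [s] and [m ++ l] equal as sets. *)
have sml : {subset s <= m ++ l}.
  move=> a sa; rewrite mem_cat mem_filter lE sa andbT orbC -neq_ltn.
  by apply: contra (indep_neq inds sa) => /eqP/hinj->.
have mls : {subset m ++ l <= s} by apply: smax.
have mlmax : max_indep (m ++ l).
  by split=> // s' inds' ss' a as'; apply/sml/(smax s') => // b /sml/ss'.
exists [rel x y | h x < h y], (edge_set m); split.
- split=> [x|y x z|x y] /=; [exact: ltnn | exact: ltn_trans |].
  by rewrite -neq_ltn; apply: contra => /eqP/hinj->.
- exact: (back_edges_spanning_tree hinj lE mback mlmax).
- move=> [x y]; rewrite inE /= -(mem_back_edges mback) orbC.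
  apply/idP/idP => [/sml|xy]; first by rewrite mem_cat lE.
  by apply: mls; rewrite mem_cat lE.
Qed.

End IndependentArcs.

(** * Generated subsemigroups and strict chains *)

Section Chains.

Set Implicit Arguments.
Unset Strict Implicit.

Variable S : finSemigroupType.
Implicit Types (A X Y : {set S}) (s : seq S).

Lemma subsemigroup_gen_min A Y :
  subsemigroup A -> Y \subset A -> subsemigroup_gen Y \subset A.
Proof. by move=> sA YA; apply: bigcap_inf; rewrite YA. Qed.

Lemma sub_subsemigroup_gen Y : Y \subset subsemigroup_gen Y.
Proof. by apply/bigcapsP=> A /andP[]. Qed.

Lemma subsemigroup_genM Y : mulg_closed (subsemigroup_gen Y).
Proof.
move=> x y /bigcapP Yx /bigcapP Yy; apply/bigcapP=> A YA.
by case/andP: (YA) => _ /subsemigroupP; apply; [apply: Yx | apply: Yy].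
Qed.

Lemma subsemigroup_genS X Y :
  X \subset Y -> subsemigroup_gen X \subset subsemigroup_gen Y.
Proof.
move=> XY; apply: subsemigroup_gen_min.
  exact/subsemigroupP/subsemigroup_genM.
exact: subset_trans XY (sub_subsemigroup_gen Y).
Qed.

(** Gives strictness a form suited to induction from the right. *)
Lemma strict_chain_rcons s x : strict_chain (rcons s x) <->
  strict_chain s /\ x \notin subsemigroup_gen [set y in s].
Proof.
have takeE i : i <= size s -> take i (rcons s x) = take i s.
  by move=> le_i; rewrite -cats1 takel_cat.
have take_all : take (size s).+1 (rcons s x) = rcons s x.
  by rewrite -(size_rcons s x) take_size.
have step : (subsemigroup_gen [set y in s] \proper
    subsemigroup_gen [set y in rcons s x]) =
    (x \notin subsemigroup_gen [set y in s]).
  rewrite properE subsemigroup_genS; last first.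
    by apply/subsetP=> y; rewrite !inE mem_rcons inE orbC => ->.
  congr (~~ _); apply/idP/idP=> [/subsetP|xs].
    apply; apply: (subsetP (sub_subsemigroup_gen _)).
    by rewrite inE mem_rcons mem_head.
  apply: subsemigroup_gen_min; first exact/subsemigroupP/subsemigroup_genM.
  apply/subsetP=> y; rewrite inE mem_rcons inE => /predU1P[->//|ys].
  by apply: (subsetP (sub_subsemigroup_gen _)); rewrite inE.
rewrite -step; split=> [ch|[ch sx] i].
- split=> [i lt_i|].
    have := ch i; rewrite size_rcons ltnS (takeE _ lt_i) (takeE _ (ltnW lt_i)).
    by apply; apply: ltnW.
  by have := ch (size s); rewrite size_rcons takeE // take_all take_size; apply.
- rewrite size_rcons ltnS leq_eqVlt => /predU1P[->|lt_i].
    by rewrite takeE // take_all take_size.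
  by rewrite !takeE ?ch // ltnW.
Qed.

Lemma strict_chain1 (x : S) : strict_chain [:: x].
Proof.
apply/(strict_chain_rcons [::]); split=> //.
have /eqP-> : [set y in [::] : seq S] == set0.
  by apply/eqP/setP=> y; rewrite !inE.
by rewrite subsemigroup_gen0 inE.
Qed.

End Chains.

(** * Faces and facets of the Brandt semigroup *)

Section BrandtFaces.

Set Implicit Arguments.
Unset Strict Implicit.

Variable n : nat.
Implicit Types (s : seq ('I_n * 'I_n)) (i j k : 'I_n) (A : {set brandt n}).

Definition with_idempotents s : {set brandt n} :=
  idempotents (brandt n) :|: [set Some a | a in s].

Lemma mem_with_idempotents s (x : brandt n) : (x \in with_idempotents s) =
  if x is Some (i, j) then (i == j) || ((i, j) \in s) else true.
Proof.
rewrite inE idempotents_brandt; case: x => [[i j]|]; rewrite !inE //=.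
rewrite mem_imset; last by move=> ? ? [].
congr (_ || _); apply/imsetP/eqP => [[k _ [-> ->]] //|->]; by exists j.
Qed.

Definition brandt_rel (W : rel 'I_n) : {set brandt n} :=
  [set x : brandt n | if x is Some (i, j) then W i j else true].

(** A nonzero product composes two pairs, so transitivity is closure; [brandt_rel W] always contains
    the zero. *)
Lemma subsemigroup_brandt_rel W : transitive W -> subsemigroup (brandt_rel W).
Proof.
move=> Wt; apply/subsemigroupP=> -[[i j]|] [[k l]|]; rewrite !inE //.
rewrite /mul /=; case: eqP => // <-; exact: Wt.
Qed.

(** The arcs along a path multiply to the pair of its ends; [i != j] excludes the empty path. *)
Lemma reach_mem s A i j : subsemigroup A -> {in s, forall a, Some a \in A} ->
  reach s i j -> i != j -> Some (i, j) \in A.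
Proof.
move=> /subsemigroupP clA sA /connectP[p]; elim: p i => [|k p IHp] i /=.
  by move=> _ ->; rewrite eqxx.
case/andP=> /sA ik pk jE _; have [<-//|kj] := eqVneq k j.
by have := clA _ _ ik (IHp k pk jE kj); rewrite /mul /= eqxx.
Qed.

(** Keep the entries that are not idempotent. By [reach_mem], an arc reachable through earlier ones
    would lie in the subsemigroup they generate. *)
Lemma strict_chain_indep (t : seq (brandt n)) : strict_chain t ->
  exists s, [/\ indep s, {in s, forall a, Some a \in t}
    & {subset t <= with_idempotents s}].
Proof.
elim/last_ind: t => [_|t x IHt /strict_chain_rcons[/IHt[s [inds st ts]] xt]].
  by exists [::].
have [xs|] := boolP (x \in with_idempotents s).
  exists s; split=> // [a /st|y]; rewrite mem_rcons inE.
    by move->; rewrite orbT.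
  by case/predU1P=> [->|/ts].
rewrite mem_with_idempotents; case: x xt => // -[i j] xt.
rewrite negb_or => /andP[ij _].
exists ((i, j) :: s); split=> [|a|y].
- rewrite /= inds andbT; apply: contra xt => rij.
  apply: reach_mem rij ij => [|a /st at_].
    exact/subsemigroupP/subsemigroup_genM.
  by apply: (subsetP (sub_subsemigroup_gen _)); rewrite inE.
- rewrite mem_rcons !inE => /predU1P[->|/st->]; by rewrite ?eqxx ?orbT.
- rewrite mem_rcons inE => /predU1P[->|/ts].
    by rewrite mem_with_idempotents mem_head orbT.
  rewrite !mem_with_idempotents; case: y => // a; case: a => k l.
  by case/orP=> H; rewrite ?inE H ?orbT.
Qed.

Lemma face_with_idempotents s : indep s -> face (with_idempotents s).
Proof.
move=> inds; pose u := [seq Some (i, i) : brandt n | i <- enum 'I_n].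
(* [s] lists the newest arc first, a chain the oldest first. *)
exists (None :: u ++ [seq Some a | a <- rev s]).
  apply/setP=> x; rewrite mem_with_idempotents !inE mem_cat.
  case: x => [[i j]|] //=; rewrite mem_map ?mem_rev; last by move=> ? ? [].
  congr (_ || _); apply/eqP/mapP => [->|[k _ [-> ->]] //].
  by exists j; rewrite ?mem_enum.
(* New entries are separated from the earlier ones by a transitive relation: the diagonal over the
   earlier points for an idempotent, [reach s] for an arc. *)
have gen_notin (W : rel 'I_n) (t : seq (brandt n)) i j : transitive W ->
    {subset t <= brandt_rel W} -> ~~ W i j ->
    Some (i, j) \notin subsemigroup_gen [set x in t].
  move=> Wt tW nW; apply: contra nW => ij.
  suff /subsetP/(_ _ ij) :
    subsemigroup_gen [set x in t] \subset brandt_rel W by rewrite inE.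
  apply: subsemigroup_gen_min; first exact: subsemigroup_brandt_rel.
  by apply/subsetP=> x; rewrite inE; apply: tW.
elim: s inds => [_|[i j] s IHs /= /andP[nij /IHs ch]].
  rewrite cats0 /u; have := enum_uniq 'I_n.
  elim/last_ind: (enum 'I_n) => [_|e i IHe] /=.
    exact: strict_chain1.
  rewrite rcons_uniq map_rcons -rcons_cons => /andP[ie /IHe che].
  apply/strict_chain_rcons; split=> //.
  apply: (gen_notin [rel j k | (j == k) && (j \in e)]) => [j k l||].
  - by move=> /= /andP[/eqP->].
  - move=> x; rewrite inE => /predU1P[->|/mapP[j je ->]]; rewrite inE //.
    by rewrite /= eqxx.
  - by rewrite /= (negPf ie) andbF.
rewrite rev_cons map_rcons -rcons_cat -rcons_cons.
apply/strict_chain_rcons; split=> //.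
apply: (gen_notin (reach s)) nij; first exact: connect_trans.
move=> x; rewrite inE mem_cat => /or3P[/eqP->|/mapP[k _ ->]|/mapP[a]].
- by rewrite inE.
- by rewrite inE; apply: connect0.
- by rewrite mem_rev => /reach_arc ra ->; rewrite inE; case: a ra.
Qed.

(** An independent extension of [s] yields a face containing [F], hence [F] itself; its arcs are no
    loops, so they already lie in [s]. *)
Lemma facet_max_indep (F : {set brandt n}) : facet F ->
  exists2 s, max_indep s & F = with_idempotents s.
Proof.
move=> [[t -> /strict_chain_indep[s [inds st ts]]] tmax].
have E s' : indep s' -> {subset s <= s'} -> with_idempotents s' = [set x in t].
  move=> inds' ss'; apply: tmax; first exact: face_with_idempotents.
  apply/subsetP=> x; rewrite inE => /ts; rewrite !mem_with_idempotents.
  by case: x => // -[i j] /orP[->//|/ss'->]; rewrite orbT.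
exists s; last by rewrite E.
split=> // s' inds' ss' [i j] ij.
have := mem_with_idempotents s (Some (i, j)).
rewrite E // -(E s') // mem_with_idempotents ij orbT.
by rewrite (negPf (indep_neq inds' ij)).
Qed.

End BrandtFaces.

Theorem theorem5p22 (n : nat) (hn : 1 <= n) (F : {set brandt n}) (hF : facet F) :
  exists (L : rel 'I_n) (T : {set {set 'I_n}}),
    [/\ strict_linear_order L, spanning_tree T
      & F = Phi L (opposite_orientation L T)].
Proof.
have [s /max_indep_tree[L [T [linL treeT sE]]] ->] := facet_max_indep hF.
exists L, T; split=> //; apply/setP=> x.
rewrite mem_with_idempotents /Phi idempotents_brandt.
case: x => [[i j]|]; rewrite ?inE //.
rewrite !mem_imset; try by move=> ? ? [].
have -> : (Some (i, j) \in [set Some (k, k) | k : 'I_n]) = (i == j).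
  by apply/imsetP/eqP => [[k _ [-> ->]] //|->]; exists j.
by rewrite sE orbA inE /= [L i j || _]orbC.
Qed.
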